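(* Let $G$ be a finite group with identity element $e$, let $n\geq 0$ be an integer, and let $$\{e\}=G_0 < G_1 < \dots < G_n = G$$ be a chain of subgroups of $G$. Let $|G| = a_1 a_2$ be any factorization of the order of $G$ with $a_1$ and $a_2$ positive integers. Suppose there exists a subset $s_1\subseteq\{1,\dots,n\}$ such that $$\prod_{i\in s_1} |G_i:G_{i-1}| = a_1$$ (equivalently, such that, letting $s_2=\{1,\dots,n\}\setminus s_1$, one has $\prod_{i\in s_2} |G_i:G_{i-1}| = a_2$). Then there exist subsets $A_1, A_2\subseteq G$ with cardinalities $|A_1|=a_1$ and $|A_2|=a_2$ such that $$G = A_1 A_2.$$
   Context: For subsets $A_1,A_2$ of a group $G$, $A_1A_2$ denotes the set product $\{xy : x\in A_1,\ y\in A_2\}$. $|G_i:G_{i-1}|$ denotes the index of the subgroup $G_{i-1}$ in $G_i$, and $H<K$ means that $H$ is a proper subgroup of $K$ (no normality is assumed). A product of integers over the empty set is $1$. *)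

(* Defs.v *)
From mathcomp Require Import all_boot all_fingroup.

Set Implicit Arguments.
Unset Strict Implicit.
Unset Printing Implicit Defensive.

(* Main.v *)
Require Import Defs.
From mathcomp Require Import all_boot all_fingroup.

Set Implicit Arguments.
Unset Strict Implicit.
Unset Printing Implicit Defensive.

(** The factorization is built by climbing the chain.  If [K <= L] are
    consecutive subgroups and [K = B1 * B2], let [T] be a set of [#|L : K|]
    coset representatives of [K] in [L].  The step [K <= L] can be charged to
    either factor: choosing left representatives gives
    [L = T * K = (T * B1) * B2], and choosing right representatives gives
    [L = K * T = B1 * (B2 * T)].  Charging each step according to its
    membership in [s1] bounds the size of each factor by the product of the
    indices charged to it ([chain_factorization]).

    Upper bounds are enough.  The two products of indices multiply to [#|G|]
    by Lagrange, so they are [a1] and [a2]; since [#|A1 * A2|] is at most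
    [#|A1| * #|A2|], covering [G] with [#|A1| <= a1] and [#|A2| <= a2] leaves
    no slack, and both bounds are equalities. *)

Lemma card_mulset_leq (gT : finGroupType) (A B : {set gT}) :
  #|(A * B)%g| <= #|A| * #|B|.
Proof. by rewrite -cardsX [(A * B)%g]curry_imset2X leq_imset_card. Qed.

Lemma right_transversal (gT : finGroupType) (K L : {group gT}) :
  K \subset L ->
  exists T : {set gT}, [/\ T \subset L, #|T| <= #|L : K|%g & (K * T)%g = L].
Proof.
move=> sKL; exists [set repr C | C in rcosets K L].
have sTL : [set repr C | C in rcosets K L] \subset L.
  apply/subsetP=> _ /imsetP[_ /rcosetsP[x Lx ->] ->].
  apply: (subsetP _ _ (mem_repr_rcoset K x)).
  by rewrite mul_subG ?sub1set.
split=> //; first exact: leq_imset_card.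
apply/eqP; rewrite eqEsubset mul_subG //=; apply/subsetP=> x Lx.
have : x \in (K :* repr (K :* x))%g by rewrite rcoset_repr rcoset_refl.
case/rcosetP=> k Kk ->; apply: mem_mulg => //.
by apply: imset_f; rewrite mem_rcosets (subsetP (mulG_subr _ _)).
Qed.

(** Inversion fixes subgroups and swaps the two sides of a product. *)
Lemma left_transversal (gT : finGroupType) (K L : {group gT}) :
  K \subset L ->
  exists T : {set gT}, [/\ T \subset L, #|T| <= #|L : K|%g & (T * K)%g = L].
Proof.
case/right_transversal=> T [sTL leT defL]; exists (T^-1)%g.
split; last by rewrite -[K : {set gT}]invGid -invMg defL invGid.
  by rewrite -(invGid L) invSg.
by rewrite card_invg.
Qed.

Lemma prod_chain_indexes (gT : finGroupType) (H : nat -> {group gT}) (n : nat) :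
  H 0 = 1%G -> (forall i, i < n -> H i \subset H i.+1) ->
  \prod_(i < n) #|H i.+1 : H i|%g = #|H n|.
Proof.
move=> H0; elim: n => [|n IHn] sH; first by rewrite big_ord0 H0 cards1.
rewrite big_ord_recr /= IHn ?Lagrange ?sH // => i lt_in.
exact/sH/ltnW.
Qed.

(** The steps are selected by a predicate on [nat], and not by a subset of
    ['I_n], so that the same selection serves at every height of the chain. *)
Lemma chain_factorization (gT : finGroupType) (H : nat -> {group gT})
    (P : pred nat) (n : nat) :
  H 0 = 1%G -> (forall i, i < n -> H i \subset H i.+1) ->
  exists A1 A2 : {set gT},
    [/\ A1 \subset H n, A2 \subset H n,
        #|A1| <= \prod_(i < n | P i) #|H i.+1 : H i|%g,
        #|A2| <= \prod_(i < n | ~~ P i) #|H i.+1 : H i|%g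
      & (A1 * A2)%g = H n].
Proof.
move=> H0; elim: n => [|n IHn] sH.
  by exists 1%g, 1%g; rewrite H0 !big_ord0 cards1 mulg1.
have sHn : H n \subset H n.+1 by exact: sH.
case: IHn => [i lt_in|B1 [B2 [sB1 sB2 le1 le2 defH]]]; first exact/sH/ltnW.
have sB1' := subset_trans sB1 sHn; have sB2' := subset_trans sB2 sHn.
case Pn: (P n).
  have [T [sT leT defT]] := left_transversal sHn.
  exists (T * B1)%g, B2; split=> //; first exact: mul_subG.
  - rewrite big_mkcond big_ord_recr /= Pn -big_mkcond mulnC.
    exact: leq_trans (card_mulset_leq _ _) (leq_mul leT le1).
  - by rewrite big_mkcond big_ord_recr /= Pn -big_mkcond muln1.
  - by rewrite -mulgA defH.
have [T [sT leT defT]] := right_transversal sHn.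
exists B1, (B2 * T)%g; split=> //; first exact: mul_subG.
- by rewrite big_mkcond big_ord_recr /= Pn -big_mkcond muln1.
- rewrite big_mkcond big_ord_recr /= Pn -big_mkcond.
  exact: leq_trans (card_mulset_leq _ _) (leq_mul le2 leT).
- by rewrite mulgA defH.
Qed.

(* The index i : 'I_n stands for the step i + 1 of the chain, i.e. for the
   pair H i < H (i + 1); the values of H beyond n are irrelevant. *)
Theorem theorem1p1 (gT : finGroupType) (G : {group gT}) (n : nat)
    (H : nat -> {group gT})
    (H_first : H 0 = 1%G) (H_last : H n = G)
    (H_chain : forall i : nat, i < n -> H i \proper H i.+1)
    (a1 a2 : nat) (a1_gt0 : 0 < a1) (a2_gt0 : 0 < a2)
    (card_G : #|G| = a1 * a2)
    (ex_s1 : exists s1 : {set 'I_n}, \prod_(i in s1) #|H i.+1 : H i|%g = a1) :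
  exists A1 A2 : {set gT},
    [/\ A1 \subset G, A2 \subset G, #|A1| = a1, #|A2| = a2
      & (A1 * A2)%g = G :> {set gT}].
Proof.
case: ex_s1 => s1 prod_s1.
have sH i : i < n -> H i \subset H i.+1 by move/H_chain/proper_sub.
pose P k := if insub k is Some j then j \in s1 else false.
have PE (i : 'I_n) : P i = (i \in s1) by rewrite /P valK.
have prod1 : \prod_(i < n | P i) #|H i.+1 : H i|%g = a1.
  by rewrite -prod_s1; apply: eq_bigl.
have prod2 : \prod_(i < n | ~~ P i) #|H i.+1 : H i|%g = a2.
  apply/eqP; rewrite -(eqn_pmul2l a1_gt0) -card_G -H_last -{1}prod1.
  by rewrite -(prod_chain_indexes H_first sH) [eqbRHS](bigID (fun i : 'I_n => P i)).
have [A1 [A2 []]] := chain_factorization P H_first sH.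
rewrite prod1 prod2 H_last => sA1 sA2 le1 le2 defG.
have leG : a1 * a2 <= #|A1| * #|A2| by rewrite -card_G -defG card_mulset_leq.
exists A1, A2; split=> //; apply/eqP; rewrite eqn_leq ?le1 ?le2 /=.
  by rewrite -(leq_pmul2r a2_gt0) (leq_trans leG) // leq_mul2l le2 orbT.
by rewrite -(leq_pmul2l a1_gt0) (leq_trans leG) // leq_mul2r le1 orbT.
Qed.
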